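(* Let $n\ge 2$, let $P=(p_1,\dots,p_n)$, $Q=(q_1,\dots,q_n)\in\Gamma_n$, and let $r,R$ be real numbers with $0<r\le \frac{p_i}{q_i}\le R<\infty$ for all $i\in\{1,\dots,n\}$. Then for every real $s\le 1$, $$\frac{r^2}{2r^s(r+1)}\,\Phi_s(P\|Q)\ \le\ G(Q\|P)\ \le\ \frac{R^2}{2R^s(R+1)}\,\Phi_s(P\|Q),$$ and for every real $s\ge 2$, $$\frac{R^2}{2R^s(R+1)}\,\Phi_s(P\|Q)\ \le\ G(Q\|P)\ \le\ \frac{r^2}{2r^s(r+1)}\,\Phi_s(P\|Q).$$
   Context: For $n\ge2$, $\Gamma_n=\{P=(p_1,\dots,p_n): p_i>0,\ \sum_{i=1}^n p_i=1\}$. For $P,Q\in\Gamma_n$ and $s\in\mathbb{R}$, the relative information of type $s$ is $\Phi_s(P\|Q)=[s(s-1)]^{-1}\left[\sum_{i=1}^n p_i^s q_i^{1-s}-1\right]$ for $s\ne 0,1$; $\Phi_0(P\|Q)=\sum_{i=1}^n q_i\ln\frac{q_i}{p_i}$; $\Phi_1(P\|Q)=\sum_{i=1}^n p_i\ln\frac{p_i}{q_i}$. The adjoint of the relative AG-divergence is $G(Q\|P)=\sum_{i=1}^n \left(\frac{p_i+q_i}{2}\right)\ln\left(\frac{p_i+q_i}{2q_i}\right)$. *)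

(* Defs.v *)
From HB Require Import structures.
From mathcomp Require Import all_boot all_order all_algebra.
From mathcomp Require Import all_classical all_reals all_analysis.

Set Implicit Arguments.
Unset Strict Implicit.
Unset Printing Implicit Defensive.

Import Order.TTheory GRing.Theory Num.Theory.
Local Open Scope ring_scope.

(** The set of complete probability distributions with positive entries. *)
Definition Gamma (K : realType) (n : nat) : set ('I_n -> K) :=
  [set P | (forall i, 0 < P i) /\ \sum_(i < n) P i = 1]%classic.
Arguments Gamma : clear implicits.

Section Divergences.
Context {K : realType} {n : nat}.
Implicit Types P Q : 'I_n -> K.

(** The two exceptional values are the limits of the generic formula, which
    is singular at s = 0 and s = 1. *)
Definition Phi (s : K) P Q : K :=
  if s == 0 then \sum_(i < n) Q i * ln (Q i / P i)
  else if s == 1 then \sum_(i < n) P i * ln (P i / Q i)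
  else (s * (s - 1))^-1 * (\sum_(i < n) P i `^ s * Q i `^ (1 - s) - 1).

(** [G Q P] is G(Q||P): as in that notation, the first argument is the one in
    the denominator of the logarithm. *)
Definition G Q P : K :=
  \sum_(i < n) (P i + Q i) / 2 * ln ((P i + Q i) / (2 * Q i)).

End Divergences.

(* Main.v *)
Require Import Defs.
From mathcomp Require Import all_boot all_order all_algebra.
From mathcomp Require Import all_classical all_reals all_analysis.
From mathcomp Require Import ring lra.

Import Order.TTheory GRing.Theory Num.Theory.
Import numFieldNormedType.Exports.
Local Open Scope ring_scope.

(** Both sides are Csiszar divergences, i.e. averages
    [\sum_i q_i f (p_i / q_i)] of a generator [f] against the distribution [Q]:
    [G(Q||P)] has the generator [ag x = (x+1)/2 * ln ((x+1)/2)], and [Phi_s] has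
    the generator [phi s], whose second derivative is [x^(s-2)] for every [s],
    including the exceptional values 0 and 1.

    Since the ratios [p_i / q_i] have [Q]-mean 1, Jensen's inequality at the
    point 1 turns a pointwise inequality between second derivatives on [r, R]
    into an inequality between divergences ([csiszar_le]).  Here the quotient
    of the second derivatives is
      [ag''(x) / phi_s''(x) = x^2 / (2 x^s (x+1))],
    which is the function of [r] and of [R] in the theorem ([curv_ratio]).  If
    [c] bounds this quotient from below (above) on [r, R], then [c * Phi_s] is
    a lower (upper) bound of [G] ([G_Phi_compare]).  For [s <= 1] the quotient
    is nondecreasing and for [s >= 2] it is nonincreasing, so its extrema over
    [r, R] are the values at the end points. *)

(** * Comparison of Csiszar divergences *)

(** The mean value theorem is used twice: once to see that [f1] increases, and
    once to compare the chord slope of [f] with the slope at [c]. *)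
Lemma convex_above_tangent {K : realType} (f f1 f2 : K -> K) (a b c x : K) :
  (forall y, a <= y <= b -> is_derive y 1 f (f1 y)) ->
  (forall y, a <= y <= b -> is_derive y 1 f1 (f2 y)) ->
  (forall y, a <= y <= b -> 0 <= f2 y) ->
  a <= c <= b -> a <= x <= b -> f c + f1 c * (x - c) <= f x.
Proof.
move=> df df1 f2_ge0 /andP[ac cb] /andP[ax xb].
have mvt (h h1 : K -> K) (u v : K) : a <= u -> u <= v -> v <= b ->
    (forall y, a <= y <= b -> is_derive y 1 h (h1 y)) ->
    exists2 z, u <= z <= v & h v - h u = h1 z * (v - u).
  move=> au uv vb dh.
  have dhuv y : y \in `[u, v] -> is_derive y 1 h (h1 y).
    rewrite in_itv /= => /andP[uy yv]; apply: dh.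
    by rewrite (le_trans au uy) (le_trans yv vb).
  have hc : ({within `[u, v], continuous h})%classic.
    by apply: derivable_within_continuous => y /dhuv [].
  have dhoo y (yuv : y \in `]u, v[) := dhuv y (subset_itv_oo_cc yuv).
  have [z zuv E] := MVT_segment uv dhoo hc.
  by exists z => //; rewrite in_itv /= in zuv.
have f1_homo u v : a <= u -> u <= v -> v <= b -> f1 u <= f1 v.
  move=> au uv vb; have [z /andP[uz zv] E] := mvt f1 f2 u v au uv vb df1.
  rewrite -subr_ge0 E mulr_ge0 ?subr_ge0// f2_ge0//.
  by rewrite (le_trans au uz) (le_trans zv vb).
have [cx|/ltW xc] := leP c x.
  have [z /andP[cz zx] E] := mvt f f1 c x ac cx xb df.
  have : f1 c <= f1 z by apply: f1_homo => //; exact: le_trans zx xb.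
  by nra.
have [z /andP[xz zc] E] := mvt f f1 x c ax xc cb df.
have : f1 z <= f1 c by apply: f1_homo => //; exact: le_trans ax xz.
by nra.
Qed.

Definition csiszar {K : realType} {n : nat} (f : K -> K) (P Q : 'I_n -> K) : K :=
  \sum_(i < n) Q i * f (P i / Q i).

(** 1 is the [Q]-average of the ratios.  This is what makes it legitimate to
    expand a generator around 1 using derivatives known on [r, R] only. *)
Lemma ratio_bounds_around1 {K : realType} {n : nat} (P Q : 'I_n -> K) (r R : K) :
  Gamma K n P -> Gamma K n Q ->
  (forall i, r <= P i / Q i <= R) -> r <= 1 <= R.
Proof.
move=> [P0 P1] [Q0 Q1] hPQ; apply/andP; split.
- rewrite -P1 -[r]mulr1 -Q1 mulr_sumr; apply: ler_sum => i _.
  by rewrite -ler_pdivlMr//; have /andP[] := hPQ i.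
- rewrite -P1 -[R]mulr1 -Q1 mulr_sumr; apply: ler_sum => i _.
  by rewrite -ler_pdivrMr//; have /andP[] := hPQ i.
Qed.

(** Jensen's inequality for the convex function [g - f]: it lies above its
    tangent at 1, and the linear part of that tangent has [Q]-average 0 because
    [P] and [Q] have the same total mass. *)
Lemma csiszar_le {K : realType} {n : nat} (P Q : 'I_n -> K) (r R : K)
    (f f1 f2 g g1 g2 : K -> K) :
  Gamma K n P -> Gamma K n Q -> (forall i, r <= P i / Q i <= R) ->
  (forall x, r <= x <= R -> is_derive x 1 f (f1 x)) ->
  (forall x, r <= x <= R -> is_derive x 1 f1 (f2 x)) ->
  (forall x, r <= x <= R -> is_derive x 1 g (g1 x)) ->
  (forall x, r <= x <= R -> is_derive x 1 g1 (g2 x)) ->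
  (forall x, r <= x <= R -> f2 x <= g2 x) ->
  f 1 = g 1 -> csiszar f P Q <= csiszar g P Q.
Proof.
move=> hP hQ hPQ df df1 dg dg1 f2g2 fg1.
have r1R := ratio_bounds_around1 P Q r R hP hQ hPQ.
case: hP hQ => [P0 P1] [Q0 Q1].
(* Adding the tangent's linear part, of total 0, makes the inequality hold
   term by term. *)
pose h1 := g1 - f1.
have -> : csiszar f P Q =
    \sum_(i < n) (Q i * f (P i / Q i) + h1 1 * (P i - Q i)).
  by rewrite big_split /= -mulr_sumr sumrB P1 Q1 subrr mulr0 addr0.
apply: ler_sum => i _; rewrite -lerBrDl -mulrBr.
have -> : P i - Q i = Q i * (P i / Q i - 1).
  by have := Q0 i; move=> ?; field; rewrite gt_eqF.
rewrite mulrCA ler_pM2l//.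
have := @convex_above_tangent K (g - f) h1 (g2 - f2) r R 1 (P i / Q i).
have gf1 : (g - f) 1 = 0 by rewrite !fctE fg1 subrr.
rewrite gf1 add0r; apply => // y yrR.
- by apply: is_deriveB; [exact: dg|exact: df].
- by apply: is_deriveB; [exact: dg1|exact: df1].
- by rewrite !fctE subr_ge0 f2g2.
Qed.

(** * The two generators *)

(** The constants make [phi s 1 = 0].  The case [s = 1] is not the limit of the
    generic formula, from which it differs by a multiple of [x - 1] that blows
    up: such a multiple has [Q]-average 0 and leaves the second derivative
    [x^(s-2)] unchanged. *)
Definition phi {K : realType} (s x : K) : K :=
  if s == 0 then - ln x
  else if s == 1 then x * ln x
  else (s * (s - 1))^-1 * (x `^ s - 1).

(** At [s = 0] the general formula already gives [- x^-1], so that only [s = 1]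
    is exceptional. *)
Definition phi1 {K : realType} (s x : K) : K :=
  if s == 1 then ln x + 1 else (s - 1)^-1 * x `^ (s - 1).

Definition ag {K : realType} (x : K) : K := (x + 1) / 2 * ln ((x + 1) / 2).

Definition ag1 {K : realType} (x : K) : K := 2^-1 * (ln ((x + 1) / 2) + 1).

Lemma Phi_csiszar {K : realType} {n : nat} (s : K) (P Q : 'I_n -> K) :
  Gamma K n P -> Gamma K n Q -> Phi s P Q = csiszar (phi s) P Q.
Proof.
move=> [P0 P1] [Q0 Q1]; rewrite /Phi /csiszar /phi.
have [_|s0] := eqVneq s 0.
  apply: eq_bigr => i _; rewrite -lnV ?posrE ?divr_gt0//.
  by rewrite invf_div.
have [_|s1] := eqVneq s 1.
  apply: eq_bigr => i _; rewrite mulrA; congr (_ * _).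
  by field; rewrite gt_eqF.
transitivity ((s * (s - 1))^-1 * \sum_(i < n) (P i `^ s * Q i `^ (1 - s) - Q i)).
  by rewrite sumrB Q1.
rewrite mulr_sumr; apply: eq_bigr => i _.
rewrite mulrCA; congr (_ * _); rewrite mulrBr mulr1; congr (_ - _).
have Qi0 := Q0 i; have Pi0 := P0 i.
rewrite powRM ?invr_ge0 ?ltW// -powR_inv1 ?ltW// -powRrM mulN1r powRN.
by rewrite powRB ?(gt_eqF Qi0) ?implybT// powRr1 ?ltW//; ring.
Qed.

Lemma G_csiszar {K : realType} {n : nat} (P Q : 'I_n -> K) :
  Gamma K n P -> Gamma K n Q -> G Q P = csiszar ag P Q.
Proof.
move=> [P0 P1] [Q0 Q1]; apply: eq_bigr => i _.
have Q0i : Q i != 0 by rewrite gt_eqF.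
rewrite /ag mulrA; congr (_ * ln _); by field.
Qed.

Lemma is_derive_phi {K : realType} (s x : K) : 0 < x ->
  is_derive x 1 (phi s) (phi1 s x).
Proof.
move=> x0; have dln := is_derive1_ln x0; have dpow := is_derive1_powR s x0.
rewrite /phi /phi1; have [->|s0] := eqVneq s 0.
  rewrite eq_sym oner_eq0.
  have -> : (fun x : K => - ln x) = - @ln K by [].
  apply: is_derive_eq.
  by rewrite !sub0r powR_inv1 ?ltW// invrN invr1 mulN1r.
have [s1|s1] := eqVneq s 1.
  have -> : (fun x : K => x * ln x) = id * @ln K by [].
  apply: is_derive_eq.
  by rewrite /GRing.scale /=; field; rewrite gt_eqF.
have -> : (fun x : K => (s * (s - 1))^-1 * (x `^ s - 1)) =
  (s * (s - 1))^-1 \*: ((@powR K ^~ s) - cst 1) by [].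
apply: is_derive_eq.
by rewrite /GRing.scale /= subr0; field; rewrite subr_eq0 s1.
Qed.

Lemma is_derive_phi1 {K : realType} (s x : K) : 0 < x ->
  is_derive x 1 (phi1 s) (x `^ (s - 2)).
Proof.
move=> x0; have dln := is_derive1_ln x0.
have dpow := is_derive1_powR (s - 1) x0; rewrite /phi1; have [->|s1] := eqVneq s 1.
  have -> : (fun x : K => ln x + 1) = @ln K + cst 1 by [].
  apply: is_derive_eq.
  by rewrite addr0 (_ : 1 - 2 = -1) ?powR_inv1 ?ltW//; ring.
have -> : (fun x : K => (s - 1)^-1 * x `^ (s - 1)) =
  (s - 1)^-1 \*: (@powR K ^~ (s - 1)) by [].
apply: is_derive_eq.
rewrite (_ : s - 2 = s - 1 - 1); last by ring.
by rewrite /GRing.scale /=; field; rewrite subr_eq0.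
Qed.

Lemma is_derive_ln_mid {K : realType} (x : K) : 0 < x ->
  is_derive x 1 (fun y : K => ln ((y + 1) / 2)) (x + 1)^-1.
Proof.
move=> x0.
have -> : (fun y : K => ln ((y + 1) / 2)) =
  @ln K \o (2^-1 \*: (id + cst 1)).
  by apply/funext => y /=; rewrite /GRing.scale /= mulrC.
have pos : 0 < (2^-1 \*: (id + cst 1) : K -> K) x.
  by rewrite /GRing.scale /= mulr_gt0// addr_gt0.
have dl := is_derive1_ln pos.
apply: is_derive_eq.
rewrite /GRing.scale /= !fctE /GRing.scale /=.
by field; rewrite gt_eqF// addr_gt0.
Qed.

Lemma is_derive_ag {K : realType} (x : K) : 0 < x ->
  is_derive x 1 ag (ag1 x).
Proof.
move=> x0; have dl := is_derive_ln_mid x x0.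
have -> : ag = (2^-1 \*: (id + cst 1)) * (fun y : K => ln ((y + 1) / 2)).
  by apply/funext => y; rewrite /ag !fctE /GRing.scale /= [_ / 2]mulrC.
apply: is_derive_eq.
rewrite /ag1 !fctE /GRing.scale /= -[_ *: _]/(_ * _) addr0 mulr1.
by field; rewrite gt_eqF// addr_gt0.
Qed.

Lemma is_derive_ag1 {K : realType} (x : K) : 0 < x ->
  is_derive x 1 ag1 (2^-1 * (x + 1)^-1).
Proof.
move=> x0; have dl := is_derive_ln_mid x x0.
have -> : ag1 = 2^-1 \*: ((fun y : K => ln ((y + 1) / 2)) + cst 1) by [].
by apply: is_derive_eq; rewrite addr0.
Qed.

(** * The quotient of the second derivatives *)

(** This is [ag''(x) / phi_s''(x)], see [curv_ratioE], written as in the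
    bounds to be proved. *)
Definition curv_ratio {K : realType} (s x : K) : K :=
  x ^+ 2 / (2 * x `^ s * (x + 1)).

Lemma curv_ratioE {K : realType} (s x : K) : 0 < x ->
  2^-1 * (x + 1)^-1 = curv_ratio s x * x `^ (s - 2).
Proof.
move=> x0; rewrite /curv_ratio powRB ?(gt_eqF x0) ?implybT// powR_mulrn ?ltW//.
by field; rewrite !gt_eqF// ?powR_gt0// addr_gt0.
Qed.

(** The quotient is half of [x^(1-s) * (x / (x+1))], a product of nonnegative
    nondecreasing functions when [s <= 1]. *)
Lemma curv_ratio_homo {K : realType} (s x y : K) : s <= 1 -> 0 < x -> x <= y ->
  curv_ratio s x <= curv_ratio s y.
Proof.
move=> s1 x0 xy; have y0 := lt_le_trans x0 xy.
have E z : 0 < z -> curv_ratio s z = 2^-1 * z `^ (1 - s) * (1 - (z + 1)^-1).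
  move=> z0; rewrite /curv_ratio powRB ?(gt_eqF z0) ?implybT// powRr1 ?ltW//.
  by field; rewrite !gt_eqF// ?powR_gt0// addr_gt0.
rewrite !E//; apply: ler_pM.
- by rewrite mulr_ge0 ?powR_ge0.
- by rewrite subr_ge0 invf_le1 ?lerDr ?ltW// addr_gt0.
- by rewrite ler_pM2l// ge0_ler_powR ?nnegrE ?subr_ge0// ltW.
- by rewrite lerB// lef_pV2 ?posrE ?addr_gt0// lerD2r.
Qed.

(** The quotient is the inverse of [2 * x^(s-2) * (x+1)], a product of positive
    nondecreasing functions when [s >= 2]. *)
Lemma curv_ratio_nhomo {K : realType} (s x y : K) : 2 <= s -> 0 < x -> x <= y ->
  curv_ratio s y <= curv_ratio s x.
Proof.
move=> s2 x0 xy; have y0 := lt_le_trans x0 xy.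
have E z : 0 < z -> curv_ratio s z = (2 * z `^ (s - 2) * (z + 1))^-1.
  move=> z0; rewrite /curv_ratio powRB ?(gt_eqF z0) ?implybT// powR_mulrn ?ltW//.
  by field; rewrite !gt_eqF// ?powR_gt0// addr_gt0.
rewrite !E// lef_pV2 ?posrE ?mulr_gt0 ?powR_gt0 ?addr_gt0//.
apply: ler_pM.
- by rewrite mulr_ge0 ?powR_ge0.
- by rewrite addr_ge0// ltW.
- by rewrite ler_pM2l// ge0_ler_powR ?nnegrE ?subr_ge0// ltW.
- by rewrite lerD2r.
Qed.

(** * Comparison of G and Phi *)

(** A bound [c] on the quotient [ag'' / phi_s''] orders [c * phi_s''] and [ag''],
    hence the two divergences; both generators vanish at 1. *)
Lemma G_Phi_compare {K : realType} {n : nat} (P Q : 'I_n -> K) (r R s c : K) :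
  Gamma K n P -> Gamma K n Q -> 0 < r -> (forall i, r <= P i / Q i <= R) ->
  ((forall x, r <= x <= R -> c <= curv_ratio s x) -> c * Phi s P Q <= G Q P) /\
  ((forall x, r <= x <= R -> curv_ratio s x <= c) -> G Q P <= c * Phi s P Q).
Proof.
move=> hP hQ r0 hPQ.
have pos x : r <= x <= R -> 0 < x by case/andP=> + _; exact: lt_le_trans.
have scaled : c * Phi s P Q = csiszar (c \*: phi s) P Q.
  rewrite (Phi_csiszar _ _ _ hP hQ) /csiszar mulr_sumr.
  by apply: eq_bigr => i _; rewrite mulrCA.
have dphi x : r <= x <= R -> is_derive x 1 (c \*: phi s) ((c \*: phi1 s) x).
  by move=> /pos/(is_derive_phi s) ?; exact: is_deriveZ.
have dphi1 x : r <= x <= R ->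
    is_derive x 1 (c \*: phi1 s) ((c \*: (@powR K ^~ (s - 2))) x).
  by move=> /pos/(is_derive_phi1 s) ?; exact: is_deriveZ.
have dag x : r <= x <= R -> is_derive x 1 ag (ag1 x).
  by move=> /pos/is_derive_ag.
have dag1 x : r <= x <= R -> is_derive x 1 ag1 (2^-1 * (x + 1)^-1).
  by move=> /pos/is_derive_ag1.
have at1 : (c \*: phi s) 1 = ag 1.
  rewrite /ag divff// ln1 mulr0 /= /phi ln1 oppr0 mulr0 powR1 subrr mulr0.
  by rewrite !if_same scaler0.
rewrite scaled (G_csiszar _ _ hP hQ); split => cmp.
- apply: (csiszar_le _ _ _ _ _ _ _ _ _ _ hP hQ hPQ dphi dphi1 dag dag1) => //.
  by move=> x xrR; rewrite (curv_ratioE s) ?ler_wpM2r ?powR_ge0 ?cmp// pos.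
- apply: (csiszar_le _ _ _ _ _ _ _ _ _ _ hP hQ hPQ dag dag1 dphi dphi1) => //.
  by move=> x xrR; rewrite (curv_ratioE s) ?ler_wpM2r ?powR_ge0 ?cmp// pos.
Qed.

Theorem theorem4p6 (K : realType) (n : nat) (hn : (2 <= n)%N)
    (P Q : 'I_n -> K) (hP : Gamma K n P) (hQ : Gamma K n Q)
    (r R : K) (hr : 0 < r)
    (hPQ : forall i : 'I_n, r <= P i / Q i /\ P i / Q i <= R) :
  (forall s : K, s <= 1 ->
     r ^+ 2 / (2 * r `^ s * (r + 1)) * Phi s P Q <= G Q P /\
     G Q P <= R ^+ 2 / (2 * R `^ s * (R + 1)) * Phi s P Q) /\
  (forall s : K, 2 <= s ->
     R ^+ 2 / (2 * R `^ s * (R + 1)) * Phi s P Q <= G Q P /\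
     G Q P <= r ^+ 2 / (2 * r `^ s * (r + 1)) * Phi s P Q).
Proof.
have bounds i : r <= P i / Q i <= R by apply/andP; exact: hPQ.
have compare s c := G_Phi_compare P Q r R s c hP hQ hr bounds.
split=> s hs; split.
- apply: (compare s (curv_ratio s r)).1 => x /andP[rx _].
  exact: curv_ratio_homo.
- apply: (compare s (curv_ratio s R)).2 => x /andP[rx xR].
  by apply: curv_ratio_homo => //; exact: lt_le_trans rx.
- apply: (compare s (curv_ratio s R)).1 => x /andP[rx xR].
  by apply: curv_ratio_nhomo => //; exact: lt_le_trans rx.
- apply: (compare s (curv_ratio s r)).2 => x /andP[rx _].
  exact: curv_ratio_nhomo.
Qed.
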